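(* Let $G$ be a finite simple connected graph with $n\ge 2$ vertices, and let $C\in\mathbf{Z}^n$ be a divisor on $G$. Suppose that the greedy chip-firing algorithm started at $C$ terminates, at a stable divisor $X_0$, and let $v_0\in\mathbf{Z}_{\ge 0}^n$ be its firing vector (the $i$-th coordinate of $v_0$ is the number of times vertex $i$ performs a lending move during the run), so that $C\xrightarrow{v_0}X_0$. Let $M_0=|v_0|_1$ be the total number of moves of the greedy algorithm. Then a closest stable divisor to $C$ is at distance at least $\dfrac{M_0}{n-1}$ from $C$; that is, every sequence of lending and borrowing moves leading from $C$ to a stable divisor consists of at least $\dfrac{M_0}{n-1}$ moves.
   Context: Let $G$ be a finite simple connected graph with vertices $1,\dots,n$, and let $d_i$ be the degree of vertex $i$. The Laplacian matrix $\Delta$ of $G$ is the $n\times n$ matrix with $\Delta_{ii}=d_i$, $\Delta_{ij}=-1$ if $i\ne j$ are adjacent, and $\Delta_{ij}=0$ otherwise. A divisor is a vector in $\mathbf{Z}^n$, recording the (possibly negative) number of chips on each vertex. For divisors $C,C'$ and $v\in\mathbf{Z}^n$, the notation $C\xrightarrow{v}C'$ means $C'=C-\Delta v$. Write $e_i$ for the $i$-th standard basis vector and $|v|_1=\sum_i|v_i|$. A lending move on vertex $i$ is $C\xrightarrow{e_i}C'$ (vertex $i$ gives one chip to each of its neighbors). A borrowing move on vertex $i$ is $C\xrightarrow{-e_i}C'$ (vertex $i$ takes one chip from each of its neighbors). Moves may be performed at any vertex of any divisor, without restriction. A divisor $C$ is stable if $C_i\le d_i-1$ for all $i$. The greedy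 chip-firing algorithm (without a sink) started at $C$: as long as there are vertices having at least as many chips as their degree, pick one of them and perform a lending move on it; repeat until the divisor is stable. The distance between two divisors is the minimal number of moves (lending or borrowing) required to reach one from the other. A closest stable divisor to $C$ is a stable divisor, reachable from $C$ by lending and borrowing moves, whose distance from $C$ is minimal among all stable divisors reachable from $C$. *)

(* Defs.v *)
From mathcomp Require Import all_boot all_order all_algebra.
Set Implicit Arguments.
Unset Strict Implicit.
Unset Printing Implicit Defensive.
Import Order.TTheory GRing.Theory Num.Theory.
Local Open Scope ring_scope.

(* Graphs on the vertex set 'I_n are given by their adjacency relation e, which
   is only meaningful when e is symmetric and irreflexive. *)

Definition deg n (e : rel 'I_n) (i : 'I_n) : nat := #|[set j | e i j]|.

Definition laplacian n (e : rel 'I_n) : 'M[int]_n :=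
  \matrix_(i, j) if i == j then (deg e i)%:Z else if e i j then -1 else 0.

Definition divisor n := 'cV[int]_n.

(* C' = fire e C v is the relation C --v--> C'. *)
Definition fire n (e : rel 'I_n) (C : divisor n) (v : 'cV[int]_n) : divisor n :=
  C - laplacian e *m v.

Definition std_basis n (i : 'I_n) : 'cV[int]_n := delta_mx i 0.

Definition norm1 n (v : 'cV[int]_n) : int := \sum_(i < n) `|v i 0|.

Inductive move n := Lend of 'I_n | Borrow of 'I_n.

Definition perform n (e : rel 'I_n) (C : divisor n) (m : move n) : divisor n :=
  match m with
  | Lend i => fire e C (std_basis i)
  | Borrow i => fire e C (- std_basis i)
  end.

Definition leads_to n (e : rel 'I_n) (C : divisor n) (ms : seq (move n))
    (C' : divisor n) : Prop :=
  foldl (perform e) C ms = C'.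

Definition reachable n (e : rel 'I_n) (C C' : divisor n) : Prop :=
  exists ms, leads_to e C ms C'.

Definition stable n (e : rel 'I_n) (C : divisor n) : Prop :=
  forall i, C i 0 <= (deg e i)%:Z - 1.

(* s lists, in order, the vertices picked during a complete (hence terminating)
   run of the greedy algorithm from C, and X is the final divisor. *)
Fixpoint greedy_run n (e : rel 'I_n) (C : divisor n) (s : seq 'I_n)
    (X : divisor n) : Prop :=
  match s with
  | [::] => stable e C /\ X = C
  | i :: s' => (deg e i)%:Z <= C i 0 /\ greedy_run e (perform e C (Lend i)) s' X
  end.

Definition firing_vector n (s : seq 'I_n) : 'cV[int]_n :=
  \col_i (count_mem i s)%:Z.

(* The distance as a relation: it has no value when C' is not reachable. *)
Definition is_distance n (e : rel 'I_n) (C C' : divisor n) (k : nat) : Prop :=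
  (exists2 ms, leads_to e C ms C' & size ms = k) /\
  (forall ms, leads_to e C ms C' -> (k <= size ms)%N).

Definition closest_stable n (e : rel 'I_n) (C X : divisor n) : Prop :=
  [/\ stable e X, reachable e C X
    & forall Y k l, stable e Y -> reachable e C Y ->
        is_distance e C X k -> is_distance e C Y l -> (k <= l)%N].

(* Main.v *)
(* Let v be the net effect of a sequence of moves leading from C to a stable
   divisor.  The least action principle says that the greedy firing vector v0 is
   below every nonnegative w such that C - Delta w is stable.  As Delta kills
   constant vectors, this applies to w = v + c for c >= 0 large enough; with
   c = max (0, - min v) it gives v0 <= v + c.  If c = 0 then |v0| <= |v|.
   Otherwise c = - v_k for some k, so that v0 vanishes at k and summing over the
   other vertices gives |v0| <= sum_(j != k) v_j + (n - 1) |v_k| <= (n - 1) |v|. *)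
Require Import Defs.
From mathcomp Require Import all_boot all_order all_algebra.
From mathcomp Require Import zify.
Set Implicit Arguments.
Unset Strict Implicit.
Unset Printing Implicit Defensive.
Import Order.TTheory GRing.Theory Num.Theory.
Local Open Scope ring_scope.

Lemma fire0 n (e : rel 'I_n) (C : divisor n) : fire e C 0 = C.
Proof. by rewrite /fire mulmx0 subr0. Qed.

Lemma fire_fire n (e : rel 'I_n) (C : divisor n) (v w : 'cV[int]_n) :
  fire e (fire e C v) w = fire e C (v + w).
Proof. by rewrite /fire mulmxDr opprD addrA. Qed.

Lemma laplacian_mulE n (e : rel 'I_n) (e_irr : irreflexive e)
    (v : 'cV[int]_n) (i : 'I_n) :
  (laplacian e *m v) i 0 = (deg e i)%:Z * v i 0 - \sum_(j | e i j) v j 0.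
Proof.
rewrite mxE (bigD1 i) //= mxE eqxx; congr (_ + _).
rewrite -sumrN big_mkcond [RHS]big_mkcond /=; apply: eq_bigr => j _.
rewrite mxE; have [->|_] := eqVneq j i; first by rewrite e_irr.
by case: ifP; rewrite ?mulN1r ?mul0r.
Qed.

Lemma laplacian_const n (e : rel 'I_n) (e_irr : irreflexive e) (c : int) :
  laplacian e *m const_mx c = 0 :> 'cV[int]_n.
Proof.
apply/colP => i; rewrite laplacian_mulE // !mxE.
under eq_bigr do rewrite mxE.
have -> : \sum_(j | e i j) c = c *+ deg e i.
  by rewrite /deg -sumr_const; apply: eq_bigl => j; rewrite inE.
by rewrite -[c *+ _]mulr_natl natz subrr.
Qed.

Lemma fire_addc n (e : rel 'I_n) (e_irr : irreflexive e) (C : divisor n)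
    (v : 'cV[int]_n) (c : int) :
  fire e C (v + const_mx c) = fire e C v.
Proof. by rewrite /fire mulmxDr laplacian_const // addr0. Qed.

Lemma firing_vector_nil n : firing_vector [::] = 0 :> 'cV[int]_n.
Proof. by apply/colP => i; rewrite !mxE. Qed.

Lemma firing_vector_cons n (i : 'I_n) (s : seq 'I_n) :
  firing_vector (i :: s) = std_basis i + firing_vector s.
Proof. by apply/colP => j; rewrite !mxE /= andbT eq_sym PoszD natz. Qed.

Lemma greedy_run_fire n (e : rel 'I_n) (C X : divisor n) (s : seq 'I_n) :
  greedy_run e C s X -> X = fire e C (firing_vector s).
Proof.
elim: s C => [|i s IHs] C /=; first by case=> _ ->; rewrite firing_vector_nil fire0.
by case=> _ /IHs ->; rewrite fire_fire firing_vector_cons.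
Qed.

(** Induction on the run: the first vertex picked must also occur in [w], so one lending move there
    can be cancelled from both sides. *)
Lemma greedy_least_action n (e : rel 'I_n) (e_irr : irreflexive e)
    (C X : divisor n) (s : seq 'I_n) (w : 'cV[int]_n) :
    greedy_run e C s X -> (forall i, 0 <= w i 0) -> stable e (fire e C w) ->
  forall i, firing_vector s i 0 <= w i 0.
Proof.
elim: s C w => [|i s IHs] C w /=.
  by move=> _ w_ge0 _ j; rewrite firing_vector_nil mxE.
case=> Ci run w_ge0 st j.
(* If [w i 0] were zero, firing [w] could only add chips at [i], which would keep at least [deg e i]
   of them, against stability. *)
have wi_gt0 : 0 < w i 0.
  rewrite lt_neqAle w_ge0 andbT; apply/eqP => wi0.
  have := st i; rewrite mxE [X in _ + X]mxE laplacian_mulE // -wi0 mulr0 sub0r opprK.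
  apply/negP; rewrite -ltNge ltrBlDr.
  apply: le_lt_trans Ci _; rewrite -addrA ltrDl ltr_wpDl //.
  by apply: sumr_ge0.
have w'_ge0 k : 0 <= (w - std_basis i) k 0.
  rewrite !mxE andbT; have [->|_] := eqVneq k i; last by rewrite subr0.
  by rewrite subr_ge0 -gtz0_ge1.
(* Firing [w - std_basis i] after lending at [i] gives the same stable divisor as firing [w] from
   [C]. *)
have := IHs _ (w - std_basis i) run w'_ge0.
rewrite fire_fire addrC subrK => /(_ st j).
by rewrite firing_vector_cons [leRHS]mxE [X in _ + X]mxE lerBrDl [X in _ -> X <= _]mxE.
Qed.

Lemma norm1_std_basis n (i : 'I_n) : norm1 (std_basis i) = 1.
Proof.
rewrite /norm1 (bigD1 i) //= mxE !eqxx big1 => [|j /negPf nji]; first by [].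
by rewrite mxE nji.
Qed.

Lemma norm1N n (v : 'cV[int]_n) : norm1 (- v) = norm1 v.
Proof. by apply: eq_bigr => i _; rewrite mxE normrN. Qed.

Lemma ler_norm1D n (v w : 'cV[int]_n) : norm1 (v + w) <= norm1 v + norm1 w.
Proof. by rewrite -big_split; apply: ler_sum => i _; rewrite mxE ler_normD. Qed.

(** Each move contributes a vector of norm 1. Only an inequality holds, since lending and borrowing
    at the same vertex cancel. *)
Lemma leads_to_fire n (e : rel 'I_n) (C X : divisor n) (ms : seq (move n)) :
  leads_to e C ms X -> exists2 v, X = fire e C v & norm1 v <= (size ms)%:Z.
Proof.
rewrite /leads_to; elim: ms C => [|m ms IHms] C /=.
  by move=> <-; exists 0; rewrite ?fire0 // /norm1 big1 // => i _; rewrite mxE.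
case/IHms => v -> v_le.
have [u -> u1] : exists2 u, perform e C m = fire e C u & norm1 u = 1.
  case: m => i; first by exists (std_basis i); rewrite ?norm1_std_basis.
  by exists (- std_basis i); rewrite ?norm1N ?norm1_std_basis.
exists (u + v); first by rewrite fire_fire.
by apply: le_trans (ler_norm1D _ _) _; rewrite u1; lia.
Qed.

Lemma norm1_greedy_le n (e : rel 'I_n) (e_irr : irreflexive e) (n_ge2 : (2 <= n)%N)
    (C X : divisor n) (s : seq 'I_n) (v : 'cV[int]_n) :
    greedy_run e C s X -> stable e (fire e C v) ->
  norm1 (firing_vector s) <= (n%:Z - 1) * norm1 v.
Proof.
move=> run st.
have -> : norm1 (firing_vector s) = \sum_i firing_vector s i 0.
  by apply: eq_bigr => i _; rewrite !mxE.
have leF i : v i 0 <= `|v i 0| by exact: ler_norm.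
have [/forallP v_ge0 | ] := boolP [forall i, 0 <= v i 0].
  have s_le : \sum_i firing_vector s i 0 <= norm1 v.
    apply: ler_sum => i _; apply: le_trans (leF i).
    exact: (greedy_least_action e_irr run).
  have : 0 <= norm1 v by apply: sumr_ge0.
  nia.
case/forallPn => k0; rewrite -ltNge => vk0_lt0.
case: (arg_minP (fun i => v i 0) (isT : predT k0)) => k _ k_min.
have vk_lt0 : v k 0 < 0 by apply: le_lt_trans vk0_lt0; apply: k_min.
(* Subtracting the minimum [v k 0] makes every entry nonnegative and leaves the fired divisor
   unchanged. *)
have s_le i : firing_vector s i 0 <= v i 0 - v k 0.
  have := greedy_least_action e_irr run (w := v + const_mx (- v k 0)).
  rewrite fire_addc // => /(_ _ st i); rewrite !mxE; apply=> j.
  by rewrite !mxE subr_ge0 k_min.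
have sum_le : \sum_i firing_vector s i 0
    <= \sum_(i | i != k) `|v i 0| + (n%:Z - 1) * `|v k 0|.
  have -> : (n%:Z - 1) * `|v k 0| = \sum_(i : 'I_n | i != k) `|v k 0|.
    rewrite sumr_const cardC1 card_ord -mulr_natl natz; congr (_ * _); lia.
  (* The term at [k] is at most [v k 0 - v k 0], that is 0; each other vertex absorbs one of the
     [n - 1] copies of the absolute value of [v k 0]. *)
  rewrite (bigD1 k) //= -big_split /= -[leRHS]add0r lerD //.
    by rewrite (le_trans (s_le k)) // subrr.
  apply: ler_sum => i _; rewrite (le_trans (s_le i)) //.
  by rewrite lerD // -normrN ler_norm.
(* The contribution of [k] is the same on both sides; the remaining sum is nonnegative and [n - 1]
   is at least 1. *)
rewrite (le_trans sum_le) // /norm1 [in leRHS](bigD1 k) //= mulrDr addrC.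
rewrite lerD2l ler_peMl //; first by apply: sumr_ge0.
lia.
Qed.

Theorem theorem1 (n : nat) (n_ge2 : (2 <= n)%N)
    (e : rel 'I_n) (e_sym : symmetric e) (e_irr : irreflexive e)
    (e_conn : forall i j, connect e i j)
    (C X0 : divisor n) (s : seq 'I_n) (greedy_s : greedy_run e C s X0)
    (v0 : 'cV[int]_n) (v0E : v0 = firing_vector s)
    (M0 : int) (M0E : M0 = norm1 v0) :
  [/\ X0 = fire e C v0,
      forall (X : divisor n) (k : nat),
        closest_stable e C X -> is_distance e C X k ->
        M0%:~R / (n%:R - 1) <= k%:R :> rat
    & forall (X : divisor n) (ms : seq (move n)),
        stable e X -> leads_to e C ms X ->
        M0%:~R / (n%:R - 1) <= (size ms)%:R :> rat].
Proof.
have bound (X : divisor n) (ms : seq (move n)) : stable e X -> leads_to e C ms X ->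
    M0%:~R / (n%:R - 1) <= (size ms)%:R :> rat.
  move=> stX /leads_to_fire[v XE v_le].
  have n1_gt0 : 0 < n%:R - 1 :> rat by rewrite subr_gt0 ltr1n.
  rewrite ler_pdivrMr //.
  have -> : (size ms)%:R * (n%:R - 1) = ((size ms)%:Z * (n%:Z - 1))%:~R :> rat.
    by rewrite rmorphM rmorphB.
  rewrite ler_int M0E v0E mulrC; rewrite XE in stX.
  apply: le_trans (norm1_greedy_le e_irr n_ge2 greedy_s stX) _.
  by rewrite ler_wpM2l //; lia.
(* A distance is attained by some sequence of moves, to which [bound] applies. *)
split=> [|X k [stX _ _] [[ms CX <-] _]|//]; last exact: bound CX.
by rewrite v0E; apply: greedy_run_fire greedy_s.
Qed.
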